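(* Let $\alpha\in(0,1)$, $T>0$, let $E$ be a real Banach space endowed with an admissible family of tensor norms, let $\tau$ be a Hausdorff topology on $\mathcal{C}^{\alpha}([0,T];E)$, let $K\subseteq \mathcal{C}^{\alpha}([0,T];E)$ be a $\tau$-compact set, and let $D$ be a linear subspace of $T_a(E^* )=\bigoplus_{n=0}^\infty (E^* )^{\otimes_a n}$ such that (1) for every $l\in D$ the map $K\ni \mathbf{x}\mapsto \langle S(\mathbf{x})_{0,T}, l\rangle$ is $\tau$-continuous; (2) $S(\mathbf{x})_{0,T}\neq S(\mathbf{x}')_{0,T}$ whenever $\mathbf{x},\mathbf{x}'\in K$, $\mathbf{x}\neq\mathbf{x}'$; (3) $\mathbf{1}=(1,0,0,\ldots)\in D$; (4) $D$ separates points in $T((E))$, i.e. for all $\mathbf{a}\neq \mathbf{b}$ in $T((E))$ there is $l\in D$ with $\langle \mathbf{a},l\rangle\neq\langle\mathbf{b},l\rangle$; (5) for all $l,l'\in D$ there exists $l''\in D$ such that $\langle S(\mathbf{x})_{0,T},l\rangle\,\langle S(\mathbf{x})_{0,T},l'\rangle=\langle S(\mathbf{x})_{0,T},l''\rangle$ for all $\mathbf{x}\in K$. Then for every $\tau$-continuous function $f\colon K\to\mathbb{R}$ and every $\epsilon>0$ there exists $l\in D$ such that $$\sup_{\mathbf{x}\in K}|\langle S(\mathbf{x})_{0,T},l\rangle-f(\mathbf{x})|<\epsilon.$$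
   Context: Tensor norms. $E^{\otimes_a n}$ is the $n$-fold algebraic tensor power ($E^{\otimes_a 0}=\mathbb{R}$). An admissible family of tensor norms for $E$ is a sequence of norms $\|\cdot\|_n$ on $E^{\otimes_a n}$, $n\ge1$ ($\|\cdot\|_1$ the norm of $E$), with completions $E^{\otimes n}$ (and $E^{\otimes 0}=\mathbb{R}$), such that (strong crossnorm family) for all $m,n\ge 1$, $x_1\in E^{\otimes m}$, $x_2\in E^{\otimes n}$ the tensor product $x_1\otimes x_2$ (extended from algebraic tensors by continuity) lies in $E^{\otimes(m+n)}$ with $\|x_1\otimes x_2\|_{m+n}=\|x_1\|_m\|x_2\|_n$; and (symmetric) $\|P_\sigma v\|_n=\|v\|_n$ for all $v\in E^{\otimes_a n}$ and permutations $\sigma$ of $\{1,\dots,n\}$, where $P_\sigma(v_1\otimes\cdots\otimes v_n)=v_{\sigma(1)}\otimes\cdots\otimes v_{\sigma(n)}$. Tensor algebra. $T((E))=\{\mathbf{a}=(\mathbf{a}^{(0)},\mathbf{a}^{(1)},\ldots):\mathbf{a}^{(n)}\in E^{\otimes n}\}$ with product $(\mathbf{a}\hat\otimes\mathbf{b})^{(n)}=\sum_{i=0}^n\mathbf{a}^{(i)}\otimes\mathbf{b}^{(n-i)}$ and unit $\mathbf{1}=(1,0,0,\ldots)$. $T^{(n)}(E)$ is the truncation to levels $0,\dots,n$ with the induced product. $T_a(E^* )=\bigoplus_{n\ge0}(E^* )^{\otimes_a n}$ (algebraic direct sum, $(E^* )^{\otimes_a 0}=\mathbb{R}$) acts on $T((E))$: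 for $l=\phi_1\otimes\cdots\otimes\phi_n$, $\langle\mathbf{a},l\rangle$ is the value at $\mathbf{a}^{(n)}$ of the linear functional $\phi_1\otimes\cdots\otimes\phi_n$ (determined on elementary tensors by $v_1\otimes\cdots\otimes v_n\mapsto\prod_j\phi_j(v_j)$ and extended by continuity to $E^{\otimes n}$), extended linearly in $l$; the pairing is assumed well defined for the elements of $D$. Rough paths. A multiplicative functional is a map $\mathbf{x}$ from $[0,T]^2$ to $T((E))$ or $T^{(n)}(E)$ with zeroth component $1$ and $\mathbf{x}_{s,t}=\mathbf{x}_{s,u}\hat\otimes\mathbf{x}_{u,t}$ for all $s,u,t\in[0,T]$. $\mathcal{C}^{\alpha,n}([0,T];E)$ is the set of multiplicative functionals $\mathbf{x}\colon[0,T]^2\to T^{(n)}(E)$ with $\|\mathbf{x}\|_{\mathcal{C}^\alpha}=\max_{1\le i\le n}\sup_{u\neq v}\big(\|\mathbf{x}^{(i)}_{u,v}\|_i/|v-u|^{i\alpha}\big)^{1/i}<\infty$, and $\mathcal{C}^\alpha([0,T];E)=\mathcal{C}^{\alpha,\lfloor1/\alpha\rfloor}([0,T];E)$. Signature. For $n\ge\lfloor1/\alpha\rfloor$ the Lyons lift $S^n(\mathbf{x})$ of $\mathbf{x}\in\mathcal{C}^\alpha([0,T];E)$ is the unique element of $\mathcal{C}^{\alpha,n}([0,T];E)$ whose truncation to levels $\le\lfloor1/\alpha\rfloor$ is $\mathbf{x}$. $S(\mathbf{x})\colon[0,T]^2\to T((E))$ is the multiplicative functional whose truncation to levels $\le n$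 is $S^n(\mathbf{x})$ for every such $n$; $S(\mathbf{x})_{0,T}$ is the signature of $\mathbf{x}$. *)

(* Defs.v *)
From HB Require Import structures.
From mathcomp Require Import all_boot all_order all_algebra.
From mathcomp Require Import perm.
From mathcomp Require Import all_classical all_reals all_analysis.

Set Implicit Arguments.
Unset Strict Implicit.
Unset Printing Implicit Defensive.

Import Order.TTheory GRing.Theory Num.Theory.
Import numFieldNormedType.Exports.

Local Open Scope classical_set_scope.
Local Open Scope ring_scope.

Section MultilinearForms.
Context {R : realType} {V : lmodType R}.

Definition replace_at n (v : 'I_n -> V) (i : 'I_n) (x : V) : 'I_n -> V :=
  fun j => if j == i then x else v j.

Definition multilinear (W : lmodType R) n (M : ('I_n -> V) -> W) : Prop :=
  forall v i, linear (fun x => M (replace_at v i x)).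

Record mform n := MForm {
  mform_fun :> ('I_n -> V) -> R^o;
  mformP : multilinear mform_fun }.

Lemma mform_ext n (M N : mform n) : M =1 N -> M = N.
Proof.
case: M N => [M hM] [N hN] /= /funext MN; case: _ / MN hN => hN.
by congr MForm; exact: Prop_irrelevance.
Qed.

End MultilinearForms.
Arguments mform {R} V n.

(* The algebraic tensor power V^(⊗ n), realised as in Ryan's "Introduction to
   Tensor Products of Banach Spaces": v_1 ⊗ ... ⊗ v_n is the evaluation
   M |-> M (v_1, ..., v_n) on n-linear forms, and V^(⊗ n) is the linear span of
   these functionals. See [tensor_univ] for the universal property.
   For n = 0 this is the line spanned by the empty tensor [tens1], which is
   identified with R. *)
Section AlgebraicTensorPower.
Context {R : realType} (V : lmodType R) (n : nat).

Definition is_tensor : {pred mform V n -> R^o} := fun u =>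
  `[< exists s : seq (R * ('I_n -> V)),
        forall M, u M = \sum_(p <- s) p.1 * M p.2 >].

Lemma is_tensor_submod : submod_closed is_tensor.
Proof.
split.
  by apply/asboolP; exists [::] => M; rewrite big_nil.
move=> a u w /asboolP[s us] /asboolP[t wt]; apply/asboolP.
exists ([seq (a * p.1, p.2) | p <- s] ++ t) => M.
rewrite big_cat big_map /= -wt; congr (_ + _).
by rewrite scalrfctE us scaler_sumr; apply: eq_bigr => p _; exact: mulrA.
Qed.

HB.instance Definition _ :=
  GRing.isSubmodClosed.Build R (mform V n -> R^o) is_tensor is_tensor_submod.

Record tens := Tens { tens_val :> mform V n -> R^o ; _ : tens_val \in is_tensor }.

HB.instance Definition _ := [isSub for tens_val].
HB.instance Definition _ := [Choice of tens by <:].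
HB.instance Definition _ := [SubChoice_isSubLmodule of tens by <:].

Lemma tens_spanned (u : tens) : exists s : seq (R * ('I_n -> V)),
  forall M, u M = \sum_(p <- s) p.1 * M p.2.
Proof. by case: u => u /= /asboolP. Qed.

Lemma tens_ext (u w : tens) : (forall M, u M = w M) -> u = w.
Proof. by move=> h; apply: val_inj; apply/funext. Qed.

Lemma elem_subproof (v : 'I_n -> V) : (fun M : mform V n => M v) \in is_tensor.
Proof. by apply/asboolP; exists [:: (1, v)] => M; rewrite big_seq1 mul1r. Qed.
Definition elem (v : 'I_n -> V) : tens := Tens (elem_subproof v).

Lemma tens_sumE (u : tens) (s : seq (R * ('I_n -> V))) :
  (forall M, u M = \sum_(p <- s) p.1 * M p.2) ->
  u = \sum_(p <- s) p.1 *: elem p.2.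
Proof.
move=> us; apply: tens_ext => M; rewrite us.
elim: s {us} => [|p s ih]; first by rewrite !big_nil.
by rewrite !big_cons ih.
Qed.

End AlgebraicTensorPower.
Arguments elem {R V n} v.

Definition tens1 {R : realType} {V : lmodType R} : tens V 0 := elem (fun=> 0).

Section SeparatingFunctional.
Context {R : realType} (W : lmodType R).

Lemma linear_separation (w : W) : w <> 0 ->
  exists2 g : W -> R^o, linear g & g w <> 0.
Proof.
move=> w0.
pose P (A : set W) := (forall a x y, A x -> A y -> A (a *: x + y)) /\ ~ A w.
have [F FP Ftot|A [[Alin Aw] Amax]] := @Zorn_bigcup W P.
  split; last by move=> [X /FP[_ Xw]] /Xw.
  move=> a x y [X FX Xx] [Y FY Yy].
  have [XY|YX] := Ftot _ _ FX FY.
  - by exists Y => //; apply: (FP _ FY).1 => //; exact: XY.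
  - by exists X => //; apply: (FP _ FX).1 => //; exact: YX.
have A0 : A 0.
  apply: contrapT => nA0; apply: (Amax [set 0]).
    have A_empty x : ~ A x.
      move=> Ax; apply: nA0.
      by have := Alin (-1) x x Ax Ax; rewrite scaleN1r addNr.
    split; first by move=> x /A_empty.
    by move=> /(_ 0 erefl) /A_empty.
  split; last by move=> /= /w0.
  by move=> a x y /= -> ->; rewrite scaler0 addr0.
have AZ a x : A x -> A (a *: x) by move=> Ax; rewrite -[_ *: _]addr0; exact: Alin.
have AD x y : A x -> A y -> A (x + y).
  by move=> Ax Ay; rewrite -[x]scale1r; exact: Alin.
have span x : exists t, A (x - t *: w).
  have [Ax|nAx] := pselect (A x); first by exists 0; rewrite scale0r subr0.
  pose B := [set y | exists2 c, A (y - c *: x) & True].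
  have AB : A `<` B.
    split; first by move=> y Ay; exists 0; rewrite // scale0r subr0.
    by move=> /(_ x); apply: contra_not nAx; apply; exists 1; rewrite // scale1r subrr.
  have Blin a y z : B y -> B z -> B (a *: y + z).
    move=> [c Ac _] [d Ad _]; exists (a * c + d) => //.
    have := Alin a _ _ Ac Ad; congr A.
    by rewrite scalerBr scalerA scalerDl opprD addrACA.
  have [c Ac _] : B w by apply: contrapT => nBw; exact: (Amax B AB).
  have c0 : c != 0 by apply: contra_notN Aw => /eqP c0; move: Ac; rewrite c0 scale0r subr0.
  exists c^-1; have := AZ (- c^-1) _ Ac; congr A.
  by rewrite scalerBr scalerA mulNr mulVf// scaleN1r opprK scaleNr addrC.
have uniq x s t : A (x - s *: w) -> A (x - t *: w) -> s = t.
  move=> As At; apply: contrapT => /eqP st; apply: Aw.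
  have := AD _ _ As (AZ (-1) _ At).
  rewrite scaleN1r opprB addrC addrA subrK -scalerBl => /(AZ (t - s)^-1).
  by rewrite scalerA mulVf ?scale1r// subr_eq0 eq_sym.
have [g gP] := choice span.
exists g; last first.
  move=> gw0; apply: Aw; have := gP w; by rewrite gw0 scale0r subr0.
move=> a x y; apply: (uniq (a *: x + y)); first exact: gP.
have := Alin a _ _ (gP x) (gP y); congr A.
by rewrite scalerBr scalerA scalerDl opprD addrACA.
Qed.

End SeparatingFunctional.

Section UniversalProperty.
Context {R : realType} {V W : lmodType R} {n : nat}.

Lemma linear_sumE (g : W -> R^o) (I : Type) (s : seq (R * I)) (f : I -> W) :
  linear g -> g (\sum_(p <- s) p.1 *: f p.2) = \sum_(p <- s) p.1 * g (f p.2).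
Proof.
move=> gl; have g0 : g 0 = 0.
  by have := gl (-1) 0 0; rewrite scaler0 addr0 scaleN1r addNr.
elim: s => [|p s ih]; first by rewrite !big_nil.
by rewrite !big_cons gl ih.
Qed.

Lemma tensor_univ (f : ('I_n -> V) -> W) : multilinear f ->
  exists! F : tens V n -> W, linear F /\ forall v, F (elem v) = f v.
Proof.
move=> fM.
pose dec (u : tens V n) s := forall M, u M = \sum_(p <- s) p.1 * M p.2.
pose val s := \sum_(p <- s) p.1 *: f p.2.
have val_inj s t : (forall M : mform V n, \sum_(p <- s) p.1 * M p.2 =
    \sum_(p <- t) p.1 * M p.2) -> val s = val t.
  move=> st; apply: contrapT => /eqP; rewrite -subr_eq0 => /eqP.
  move=> /linear_separation[g gl]; apply.
  have gM : multilinear (g \o f) by move=> v i a x y /=; rewrite fM gl.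
  have gB x y : g (x - y) = g x - g y.
    by rewrite addrC -scaleN1r gl scaleN1r addrC.
  rewrite gB !linear_sumE//.
  by apply/eqP; rewrite subr_eq0; apply/eqP; exact: (st (MForm gM)).
have [d dP] := choice (@tens_spanned R V n).
exists (fun u => val (d u)); split; first split.
- move=> a u w.
  have -> : a *: val (d u) + val (d w) =
      val ([seq (a * p.1, p.2) | p <- d u] ++ d w).
    rewrite /val big_cat big_map /= scaler_sumr; congr (_ + _).
    by apply: eq_bigr => p _; rewrite scalerA.
  apply: val_inj => M; rewrite big_cat big_map /=.
  transitivity (a * u M + w M); first by rewrite -dP.
  rewrite !dP mulr_sumr; congr (_ + _).
  by apply: eq_bigr => p _; rewrite mulrA.
- move=> v; have -> : f v = val [:: (1, v)] by rewrite /val big_seq1 scale1r.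
  by apply: val_inj => M; rewrite -dP big_seq1 mul1r.
move=> G [Gl Gf]; apply/funext => u.
have G0 : G 0 = 0.
  by have := Gl (-1) 0 0; rewrite scaler0 addr0 scaleN1r addNr.
have -> : G u = G (\sum_(p <- d u) p.1 *: elem p.2) by rewrite -(tens_sumE (dP u)).
rewrite /val; elim: (d u) => [|p s ih]; first by rewrite !big_nil G0.
by rewrite !big_cons Gl -ih Gf.
Qed.

End UniversalProperty.

Section TensorOperations.
Context {R : realType} {V : lmodType R}.

Definition concat m n (v : 'I_m -> V) (w : 'I_n -> V) : 'I_(m + n) -> V :=
  fun i => match fintype.split i with inl j => v j | inr k => w k end.

Lemma concat_replacel m n (v : 'I_m -> V) (w : 'I_n -> V) j x :
  concat (replace_at v j x) w = replace_at (concat v w) (lshift n j) x.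
Proof.
apply/funext => i; rewrite /concat /replace_at; case: splitP => k ik.
  by have -> : (i == lshift n j) = (k == j) by rewrite -!val_eqE /= ik.
have -> // : (i == lshift n j) = false.
by rewrite -val_eqE /= ik gtn_eqF// ltn_addr.
Qed.

Lemma concat_replacer m n (v : 'I_m -> V) (w : 'I_n -> V) k x :
  concat v (replace_at w k x) = replace_at (concat v w) (rshift m k) x.
Proof.
apply/funext => i; rewrite /concat /replace_at; case: splitP => j ij.
  have -> // : (i == rshift m k) = false.
  by rewrite -val_eqE /= ij ltn_eqF// ltn_addr.
by have -> : (i == rshift m k) = (j == k) by rewrite -!val_eqE /= ij eqn_add2l.
Qed.

Lemma tmul_inner_subproof m n (M : mform V (m + n)) (v : 'I_m -> V) :
  multilinear (fun w : 'I_n -> V => M (concat v w)).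
Proof. by move=> w i a x y; rewrite !concat_replacer mformP. Qed.
Definition tmul_inner m n M v : mform V n := MForm (@tmul_inner_subproof m n M v).

Lemma tmul_outer_subproof m n (M : mform V (m + n)) (w : tens V n) :
  multilinear (fun v : 'I_m -> V => w (tmul_inner M v)).
Proof.
move=> v i a x y; have [s ws] := tens_spanned w.
rewrite !ws scaler_sumr -big_split; apply: eq_bigr => p _ /=.
by rewrite !concat_replacel mformP mulrDr; congr (_ + _); rewrite mulrCA.
Qed.
Definition tmul_outer m n M w : mform V m := MForm (@tmul_outer_subproof m n M w).

Lemma tmul_subproof m n (u : tens V m) (w : tens V n) :
  (fun M => u (tmul_outer M w)) \in @is_tensor R V (m + n).
Proof.
have [s us] := tens_spanned u; have [t wt] := tens_spanned w.
apply/asboolP; exists [seq (p.1 * q.1, concat p.2 q.2) | p <- s, q <- t] => M.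
rewrite us big_allpairs_dep; apply: eq_bigr => p _ /=; rewrite wt mulr_sumr.
by apply: eq_bigr => q _; rewrite mulrA.
Qed.

(* The product V^(⊗ m) x V^(⊗ n) -> V^(⊗ (m + n)); see [tmul_elem]. *)
Definition tmul m n (u : tens V m) (w : tens V n) : tens V (m + n) :=
  Tens (tmul_subproof u w).

Lemma tmul_elem m n (v : 'I_m -> V) (w : 'I_n -> V) :
  tmul (elem v) (elem w) = elem (concat v w).
Proof. exact: tens_ext. Qed.

Lemma tmulDl m n (u u' : tens V m) (w : tens V n) a :
  tmul (a *: u + u') w = a *: tmul u w + tmul u' w.
Proof. exact: tens_ext. Qed.

Lemma tmulDr m n (u : tens V m) (w w' : tens V n) a :
  tmul u (a *: w + w') = a *: tmul u w + tmul u w'.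
Proof.
have [s us] := tens_spanned u; apply: tens_ext => M.
transitivity (a * tmul u w M + tmul u w' M); last by [].
rewrite /= !us mulr_sumr -big_split; apply: eq_bigr => p _ /=.
by rewrite mulrDr mulrCA.
Qed.

Lemma tperm_subproof n (s : 'S_n) (M : mform V n) :
  multilinear (fun v : 'I_n -> V => M (v \o s)).
Proof.
move=> v i a x y.
have rs z : replace_at v i z \o s = replace_at (v \o s) (s^-1%g i) z.
  apply/funext => j; rewrite /replace_at /= -(inj_eq (@perm_inj _ s) j).
  by rewrite permKV.
by rewrite !rs mformP.
Qed.

Lemma tens_perm_subproof n (s : 'S_n) (u : tens V n) :
  (fun M => u (MForm (tperm_subproof s M))) \in @is_tensor R V n.
Proof.
have [t ut] := tens_spanned u; apply/asboolP.
exists [seq (p.1, p.2 \o s) | p <- t] => M.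
by rewrite ut big_map.
Qed.

(* The operator P_s; see [tens_perm_elem]. *)
Definition tens_perm n (s : 'S_n) (u : tens V n) : tens V n :=
  Tens (tens_perm_subproof s u).

Lemma tens_perm_elem n (s : 'S_n) (v : 'I_n -> V) :
  tens_perm s (elem v) = elem (fun j => v (s j)).
Proof. exact: tens_ext. Qed.

Lemma tens_perm_linear n (s : 'S_n) : linear (@tens_perm n s).
Proof. by move=> a u w; exact: tens_ext. Qed.

End TensorOperations.

Section TopologicalDual.
Context {R : realType} (E : normedModType R).

Definition is_dual : {pred E -> R^o} := fun f => `[< linear f /\ continuous f >].

Lemma is_dual_submod : submod_closed is_dual.
Proof.
split.
  apply/asboolP; split; last exact: cst_continuous.
  by move=> a x y; rewrite /= scaler0 addr0.
move=> a f g /asboolP[fl fc] /asboolP[gl gc]; apply/asboolP; split.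
  move=> b x y; rewrite /= !scalrfctE !addrfctE fl gl.
  by rewrite !scalerDr !scalerA mulrC addrACA.
move=> x; apply: continuousD; last exact: gc.
by apply: continuousZl_tmp; exact: fc.
Qed.

HB.instance Definition _ :=
  GRing.isSubmodClosed.Build R (E -> R^o) is_dual is_dual_submod.

Record dual := Dual { dual_fun :> E -> R^o ; _ : dual_fun \in is_dual }.

HB.instance Definition _ := [isSub for dual_fun].
HB.instance Definition _ := [Choice of dual by <:].
HB.instance Definition _ := [SubChoice_isSubLmodule of dual by <:].

Lemma dual_linear (phi : dual) : linear phi.
Proof. by case: phi => phi /= /asboolP[]. Qed.

Lemma dual_continuous (phi : dual) : continuous phi.
Proof. by case: phi => phi /= /asboolP[]. Qed.

End TopologicalDual.

Section AlgebraicPairing.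
Context {R : realType} {E : normedModType R}.

Lemma dual_form_subproof n (phi : 'I_n -> dual E) :
  multilinear (fun v : 'I_n -> E => (\prod_j phi j (v j) : R^o)).
Proof.
move=> v i a x y.
have prodE z : \prod_j phi j (replace_at v i z j) =
    phi i z * \prod_(j | j != i) phi j (v j).
  rewrite (bigD1 i)//= /replace_at eqxx; congr (_ * _).
  by apply: eq_bigr => j /negbTE ->.
by rewrite !prodE dual_linear mulrDl; congr (_ + _); rewrite -mulrA.
Qed.
Definition dual_form n phi : mform E n := MForm (@dual_form_subproof n phi).

Lemma dual_eval_subproof n (u : tens E n) :
  multilinear (fun phi : 'I_n -> dual E => u (dual_form phi)).
Proof.
move=> phi i a x y; have [s us] := tens_spanned u.
rewrite !us scaler_sumr -big_split; apply: eq_bigr => p _ /=.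
have prodE z : \prod_j replace_at phi i z j (p.2 j) =
    z (p.2 i) * \prod_(j | j != i) phi j (p.2 j).
  rewrite (bigD1 i)//= /replace_at eqxx; congr (_ * _).
  by apply: eq_bigr => j /negbTE ->.
by rewrite !prodE /= mulrDl mulrDr; congr (_ + _); rewrite -mulrA mulrCA.
Qed.
Definition dual_eval n u : mform (dual E) n := MForm (@dual_eval_subproof n u).

(* The linear functional on E^(⊗ n) attached to l in (E^* )^(⊗ n);
   see [tens_pair_elem]. *)
Definition tens_pair n (l : tens (dual E) n) (u : tens E n) : R :=
  l (dual_eval u).

Lemma tens_pair_elem n (phi : 'I_n -> dual E) (v : 'I_n -> E) :
  tens_pair (elem phi) (elem v) = \prod_j phi j (v j).
Proof. by []. Qed.

Lemma tens_pairDl n (l l' : tens (dual E) n) (u : tens E n) a :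
  tens_pair (a *: l + l') u = a * tens_pair l u + tens_pair l' u.
Proof. by []. Qed.

Lemma tens_pairDr n (l : tens (dual E) n) (u w : tens E n) a :
  tens_pair l (a *: u + w) = a * tens_pair l u + tens_pair l w.
Proof.
have [s ls] := tens_spanned l.
rewrite /tens_pair !ls mulr_sumr -big_split; apply: eq_bigr => p _ /=.
by rewrite mulrDr mulrCA.
Qed.

End AlgebraicPairing.

Section DirectSum.
Context {R : realType} (M : nat -> lmodType R).

Definition graded := forall n, M n.
HB.instance Definition _ := Choice.on graded.

Let grA : associative (fun f g : graded => (fun n => f n + g n) : graded).
Proof. by move=> f g h; apply: functional_extensionality_dep => n; exact: addrA. Qed.
Let grC : commutative (fun f g : graded => (fun n => f n + g n) : graded).
Proof. by move=> f g; apply: functional_extensionality_dep => n; exact: addrC. Qed.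
Let gr0 : left_id ((fun=> 0) : graded) (fun f g : graded => fun n => f n + g n).
Proof. by move=> f; apply: functional_extensionality_dep => n; exact: add0r. Qed.
Let grN : left_inverse ((fun=> 0) : graded) (fun f : graded => fun n => - f n)
  (fun f g : graded => fun n => f n + g n).
Proof. by move=> f; apply: functional_extensionality_dep => n; exact: addNr. Qed.
HB.instance Definition _ := GRing.isZmodule.Build graded grA grC gr0 grN.

Let grZA a b (f : graded) :
  (fun n => a *: (b *: f n)) = (fun n => (a * b) *: f n) :> graded.
Proof. by apply: functional_extensionality_dep => n; exact: scalerA. Qed.
Let gr1 : left_id 1 (fun a (f : graded) => (fun n => a *: f n) : graded).
Proof. by move=> f; apply: functional_extensionality_dep => n; exact: scale1r. Qed.
Let grDr : right_distributive (fun a (f : graded) => (fun n => a *: f n) : graded) +%R.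
Proof. by move=> a f g; apply: functional_extensionality_dep => n; exact: scalerDr. Qed.
Let grDl (f : graded) :
  {morph (fun a => (fun n => a *: f n) : graded) : a b / a + b >-> a + b}.
Proof. by move=> a b; apply: functional_extensionality_dep => n; exact: scalerDl. Qed.
HB.instance Definition _ :=
  GRing.Zmodule_isLmodule.Build R graded grZA gr1 grDr grDl.

Definition finitely_supported : {pred graded} := fun l =>
  `[< exists N, forall n, (N <= n)%N -> l n = 0 >].

Lemma finitely_supported_submod : submod_closed finitely_supported.
Proof.
split; first by apply/asboolP; exists 0%N.
move=> a l l' /asboolP[N lN] /asboolP[N' lN']; apply/asboolP.
exists (maxn N N') => n; rewrite geq_max => /andP[nN nN'].
transitivity (a *: l n + l' n); first by [].
by rewrite lN// lN'// scaler0 addr0.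
Qed.

HB.instance Definition _ := GRing.isSubmodClosed.Build R graded
  finitely_supported finitely_supported_submod.

Record dsum := Dsum {
  dsum_val : graded ; _ : dsum_val \in finitely_supported }.

HB.instance Definition _ := [isSub for dsum_val].
HB.instance Definition _ := [Choice of dsum by <:].
HB.instance Definition _ := [SubChoice_isSubLmodule of dsum by <:].

End DirectSum.

(* T_a(E^* ) *)
Definition dual_tensors {R : realType} (E : normedModType R) :=
  dsum (fun n => tens (dual E) n : lmodType R).

Definition dual_one_graded {R : realType} (E : normedModType R) :
    graded (fun n => tens (dual E) n : lmodType R) :=
  fun n => if n is 0%N then tens1 else 0.

Lemma dual_one_subproof {R : realType} (E : normedModType R) :
  dual_one_graded E \in @finitely_supported R (fun n => tens (dual E) n : lmodType R).
Proof. by apply/asboolP; exists 1%N; case. Qed.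

Definition dual_one {R : realType} (E : normedModType R) : dual_tensors E :=
  Dsum (dual_one_subproof E).

Record admissible_tensor_norms (R : realType) (E : completeNormedModType R) := {
  tnorm : forall n, tens E n -> R ;
  tnormD : forall n (u w : tens E n), tnorm (u + w) <= tnorm u + tnorm w ;
  tnormZ : forall n a (u : tens E n), tnorm (a *: u) = `|a| * tnorm u ;
  tnorm_eq0 : forall n (u : tens E n), tnorm u = 0 -> u = 0 ;
  tnorm_level0 : forall a : R, tnorm (a *: (tens1 : tens E 0)) = `|a| ;
  tnorm_level1 : forall v : E, tnorm (elem (fun _ : 'I_1 => v)) = `|v| ;
  (* the completion of (E^(⊗ n), tnorm) *)
  tpow : nat -> completeNormedModType R ;
  temb : forall n, {linear tens E n -> tpow n} ;
  temb_norm : forall n (u : tens E n), `|temb n u| = tnorm u ;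
  temb_dense : forall n, dense (range (temb n)) ;
  (* [tmul] extended by continuity *)
  cmul : forall m n, tpow m -> tpow n -> tpow (m + n) ;
  cmul_temb : forall m n (u : tens E m) (w : tens E n),
    cmul (temb m u) (temb n w) = temb (m + n) (tmul u w) ;
  cmul_continuous : forall m n,
    continuous (fun p : tpow m * tpow n => cmul p.1 p.2) ;
  cmul_norm : forall m n (x : tpow m) (y : tpow n),
    (0 < m)%N -> (0 < n)%N -> `|cmul x y| = `|x| * `|y| ;
  tnorm_sym : forall n (s : 'S_n) (u : tens E n), tnorm (tens_perm s u) = tnorm u }.

Section TensorAlgebra.
Context {R : realType} {E : completeNormedModType R}
  (TN : admissible_tensor_norms E).
Notation "'E^⊗' n" := (tpow TN n) (at level 10, n at level 8).

(* T((E)) and T^(n)(E) *)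
Definition tseries := forall k : nat, E^⊗ k.
Definition ttrunc (n : nat) := forall k : 'I_n.+1, E^⊗ k.
HB.instance Definition _ := Choice.on tseries.
HB.instance Definition _ n := Choice.on (ttrunc n).

Definition tcast m n (e : m = n) (x : E^⊗ m) : E^⊗ n := ecast k (E^⊗ k) e x.

Definition scalar_one : E^⊗ 0 := temb TN 0 tens1.

Definition tseries_mul (a b : tseries) : tseries := fun k =>
  \sum_(i < k.+1) tcast (subnKC (leq_ord i)) (cmul (a i) (b (k - i)%N)).

Definition ttrunc_mul n (a b : ttrunc n) : ttrunc n := fun k =>
  \sum_(i < k.+1) tcast (subnKC (leq_ord i))
    (cmul (a (widen_ord (ltn_ord k) i))
          (b (Ordinal (leq_ltn_trans (leq_subr i k) (ltn_ord k))))).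

Definition tseries_one : tseries := fun k => if k is 0%N then scalar_one else 0.
Definition tseries_trunc n (a : tseries) : ttrunc n := fun k => a k.
Definition ttrunc_trunc m n (lemn : (m <= n)%N) (a : ttrunc n) : ttrunc m :=
  fun k => a (widen_ord (lemn : (m < n.+1)%N) k).

(* The functional [tens_pair l] extended by continuity to E^⊗ n; the extension
   is unique since E^(⊗_a n) is dense, and the junk value 0 is only taken when
   there is none. *)
Definition extends_pair n (l : tens (dual E) n) : set (E^⊗ n -> R) :=
  [set h | continuous h /\ forall u : tens E n, h (temb TN n u) = tens_pair l u].
Definition ext_pair n (l : tens (dual E) n) : E^⊗ n -> R :=
  xget (fun=> 0) (extends_pair l).

Definition pairing_defined (l : dual_tensors E) : Prop :=
  forall n, extends_pair (dsum_val l n) !=set0.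

Definition pairing (a : tseries) (l : dual_tensors E) : R :=
  \sum_(n \in [set: nat]) ext_pair (dsum_val l n) (a n).

End TensorAlgebra.
Arguments tseries_trunc {R E TN} n a.

Section RoughPaths.
Context {R : realType} {E : completeNormedModType R}
  (TN : admissible_tensor_norms E) (alpha T : R).

(* [0, T] as a type, so that two functionals are equal iff they agree there. *)
Definition time := {t : R | 0 <= t <= T}.

Definition ttrunc_multiplicative n (x : time -> time -> ttrunc TN n) : Prop :=
  (forall s t, x s t ord0 = scalar_one TN) /\
  (forall s u t, x s t = ttrunc_mul (x s u) (x u t)).

Definition tseries_multiplicative (x : time -> time -> tseries TN) : Prop :=
  (forall s t, x s t 0%N = scalar_one TN) /\
  (forall s u t, x s t = tseries_mul (x s u) (x u t)).

Definition holder_norm n (x : time -> time -> ttrunc TN n) : \bar R :=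
  \big[maxe/0%E]_(i < n.+1 | (0 < i)%N)
    ereal_sup [set ((`|x p.1 p.2 i| / `|val p.2 - val p.1| `^ (i%:R * alpha))
                      `^ (i%:R^-1))%:E
              | p in [set p : time * time | p.1 != p.2]].

(* C^{alpha,n}([0,T];E) *)
Definition holder_functionals n : set (time -> time -> ttrunc TN n) :=
  [set x | ttrunc_multiplicative x /\ (holder_norm x < +oo)%E].

Definition rough_level : nat := Num.truncn alpha^-1.

(* C^alpha([0,T];E) *)
Definition rough_path := set_type (@holder_functionals rough_level).

(* The junk values of the next two definitions are only taken when no such
   functional exists, which Lyons' extension theorem excludes. *)
Definition lyons_lift n (len : (rough_level <= n)%N) (x : rough_path) :
    time -> time -> ttrunc TN n :=
  xget (fun _ _ => tseries_trunc n (tseries_one TN))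
    [set y | holder_functionals y /\
             forall s t, ttrunc_trunc len (y s t) = val x s t].

Definition signature_map (x : rough_path) : time -> time -> tseries TN :=
  xget (fun _ _ => tseries_one TN)
    [set S | tseries_multiplicative S /\
             forall n (len : (rough_level <= n)%N) s t,
               tseries_trunc n (S s t) = lyons_lift len x s t].

Definition time_start (T_gt0 : 0 < T) : time :=
  exist _ 0 (introT andP (conj (lexx 0) (ltW T_gt0))).
Definition time_end (T_gt0 : 0 < T) : time :=
  exist _ T (introT andP (conj (ltW T_gt0) (lexx T))).

Definition signature (T_gt0 : 0 < T) (x : rough_path) : tseries TN :=
  signature_map x (time_start T_gt0) (time_end T_gt0).

End RoughPaths.

Record topology_on (X : Type) := {
  tau_open : set (set X) ;
  tau_openT : tau_open setT ;
  tau_openI : setI_closed tau_open ;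
  tau_open_bigU : forall (I : Type) (f : I -> set X),
    (forall i, tau_open (f i)) -> tau_open (\bigcup_i f i) }.

Definition topologized (X : Type) (tau : topology_on X) : Type := X.

Section Topologized.
Context {X : Type} (tau : topology_on X).
HB.instance Definition _ := gen_eqMixin (topologized tau).
HB.instance Definition _ := gen_choiceMixin (topologized tau).
HB.instance Definition _ := isOpenTopological.Build (topologized tau)
  (tau_openT tau) (@tau_openI _ tau) (@tau_open_bigU _ tau).

Lemma topologized_openE (A : set (topologized tau)) : open A = tau_open tau A.
Proof. by []. Qed.
End Topologized.

(* Main.v *)
Require Import Defs.
From mathcomp Require Import all_boot all_order all_algebra.
From mathcomp Require Import all_classical all_reals all_analysis.
From mathcomp Require Import ring lra.

Set Implicit Arguments.
Unset Strict Implicit.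
Unset Printing Implicit Defensive.

Import Order.TTheory GRing.Theory Num.Theory.
Import numFieldNormedType.Exports.

Local Open Scope classical_set_scope.
Local Open Scope ring_scope.

(** The theorem is the Stone-Weierstrass theorem on the compact set [K], applied
to the functions [x |-> pairing (signature x) l] with [l] in [D].

These functions, read modulo equality on [K], form an algebra: the pairing is
linear in [l] ([pairing_lin]), the unit tensor gives the constant 1 because a
signature has zeroth component 1 ([pairing_one], [signature_level0]), and
products stay in the family by the shuffle-type hypothesis [D_mul]. They separate
the points of [K], since the signature is injective on [K] and [D] separates
tensor series. Both the pairing and the signature are defined by choice with a
junk value. For the pairing with members of [D] this is harmless because the
continuous extension of a functional on algebraic tensors is unique, by density
([ext_pair_unique]); for the signature, because the junk value also has zeroth
component 1.

[stone_weierstrass] follows the classical lattice argument. The absolute value is a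
uniform limit of polynomials on [[-1, 1]] ([abs_approx_error]), so the uniform
closure of the algebra is stable under [|.|], hence under [max] and [min]. Point
separation interpolates the target [f] at any two points, and two applications of
compactness, both instances of [compact_majorant], turn this pointwise
interpolation into a two-sided uniform bound. *)

(** * Polynomial approximation of the absolute value *)

(** [abs_approx t n] is a polynomial in [t], produced by the iteration
[p |-> p + (t^2 - p^2) / 2], whose nonnegative fixed point is [|t|]. *)
Fixpoint abs_approx {R : realType} (t : R) (n : nat) : R :=
  if n is m.+1 then abs_approx t m + 2^-1 * (t ^+ 2 - abs_approx t m ^+ 2)
  else 0.

(** With [e := |t| - p], one step of the iteration multiplies [e] by
[1 - (|t| + p) / 2], which is at most [1 - |t| / 2] as long as [p] is nonnegative.
The weight [2 + n |t|] is chosen so that its growth is absorbed by this factor. *)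
Lemma abs_approx_bound (R : realType) (t : R) (n : nat) : `|t| <= 1 ->
  0 <= abs_approx t n <= `|t| /\
  (`|t| - abs_approx t n) * (2 + n%:R * `|t|) <= 2 * `|t|.
Proof.
move: (normr_ge0 t) (real_normK (num_real t)).
move=> a0 ta a1.
elim: n => [|n [/andP[p0 pa] IH]] /=; first by rewrite mul0r; split; lra.
rewrite -ta.
move: (abs_approx t n) p0 pa IH => p p0 pa IH.
move: (`|t|) a0 a1 p0 pa IH => a a0 a1 p0 pa.
have n0 : 0 <= n%:R :> R by [].
rewrite -[n.+1]addn1 natrD; move: (n%:R : R) n0 => m m0 IH.
have e0 : 0 <= a - p by lra.
split; first by apply/andP; split; nra.
have -> : a - (p + 2^-1 * (a ^+ 2 - p ^+ 2)) = (a - p) * (1 - (a + p) / 2).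
  by field.
have h1 : (a - p) * (1 - (a + p) / 2) * (2 + (m + 1) * a) <=
          (a - p) * ((1 - a / 2) * (2 + (m + 1) * a)).
  rewrite -mulrA; apply: ler_wpM2l => //; apply: ler_wpM2r; last by lra.
  nra.
apply: le_trans h1 (le_trans _ IH); apply: ler_wpM2l => //.
have : 0 <= a * (m * a + a) by rewrite mulr_ge0// addr_ge0// mulr_ge0.
lra.
Qed.

Lemma abs_approx_error (R : realType) (t : R) (n : nat) : `|t| <= 1 ->
  `|abs_approx t n - `|t| | * n%:R <= 2.
Proof.
move=> t1; have [/andP[p0 pt] H] := abs_approx_bound n t1.
rewrite distrC ger0_norm ?subr_ge0//.
have := normr_ge0 t; rewrite le_eqVlt => /orP[/eqP t0|t0].
  have -> : `|t| - abs_approx t n = 0 by lra.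
  by rewrite mul0r.
rewrite -(ler_pM2r t0); apply: le_trans H.
have : 0 <= `|t| - abs_approx t n by rewrite subr_ge0.
lra.
Qed.

(** * Compactness *)

(** If no member of [L] dominated [f] on [K], the sets of points of [K] where a given
[h] in [L] fails to do so would be nonempty, and a base of a filter since [L] is
stable under [max]. At a cluster point of this filter every [h] in [L] would be at
most [f], by continuity. This spares the induction on a finite subcover. *)
Lemma compact_majorant (R : realType) (X : topologicalType) (K : set X)
    (L : set (X -> R)) (f : X -> R) :
  compact K -> continuous f -> L !=set0 -> (forall h, L h -> continuous h) ->
  (forall h k, L h -> L k -> L (h \max k)) ->
  (forall x, K x -> exists2 h, L h & f x < h x) ->
  exists2 h, L h & forall x, K x -> f x < h x.
Proof.
move=> Kc fc [h0 Lh0] Lc Lmax Lf; apply: contrapT => nomaj.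
pose bad h := K `&` [set x | h x <= f x].
pose F : set_system X := [set A | exists2 h, L h & bad h `<=` A].
have Ffilter : ProperFilter F.
  split; last first.
    split; first by exists h0.
    - move=> A B [h Lh hA] [k Lk kB]; exists (h \max k); first exact: Lmax.
      by move=> x [Kx]; rewrite /= ge_max => /andP[hx kx]; split; [apply: hA|apply: kB].
    - by move=> A B AB [h Lh hA]; exists h => //; exact: subset_trans AB.
  move=> [h Lh h_sub]; apply: nomaj; exists h => // x Kx.
  by rewrite ltNge; apply/negP => hfx; exact: (h_sub x).
have [x [Kx clx]] := Kc F Ffilter (ex_intro2 _ _ h0 Lh0 (@subIsetl _ _ _)).
have [h Lh fhx] := Lf x Kx.
have Fh : F (bad h) by exists h.
have nh : nbhs x [set y | 0 < (h - f) y].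
  apply: (@cvgr_gt _ _ (nbhs x) _ (h - f) ((h - f) x)).
    by apply: cvgB; [exact: Lc|exact: fc].
  by rewrite subr_gt0.
have [y [[_ hfy]]] := clx _ _ Fh nh.
by rewrite /= subr_gt0 ltNge hfy.
Qed.

(** * The Stone-Weierstrass theorem *)

Record function_algebra (R : realType) (X : Type) (A : set (X -> R)) : Prop := {
  fun_alg1 : A (fun=> 1) ;
  fun_algL : forall a g h, A g -> A h -> A (fun x => a * g x + h x) ;
  fun_algM : forall g h, A g -> A h -> A (fun x => g x * h x) }.

Definition unif_closure (R : realType) (X : Type) (K : set X)
    (A : set (X -> R)) : set (X -> R) :=
  [set f | forall e, 0 < e ->
     exists2 h, A h & forall x, K x -> `|h x - f x| < e].

Section StoneWeierstrass.
Context {R : realType} {X : topologicalType} (K : set X) (A : set (X -> R)).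
Context (Kcompact : compact K) (Aalg : function_algebra A).
Context (Acont : forall g, A g -> continuous g).

Lemma fun_alg_cst c : A (fun=> c).
Proof.
have A1 := fun_alg1 Aalg.
rewrite (_ : (fun=> c) = (fun x : X => (c - 1) * 1 + 1)); first exact: fun_algL.
by apply/funext => x; ring.
Qed.

Lemma continuous_bounded (g : X -> R) : continuous g ->
  exists2 c, 0 < c & forall x, K x -> `|g x| < c.
Proof.
move=> gc; have [h [c ->] gh] : exists2 h, (exists c, h = fun=> c) &
    forall x, K x -> `|g x| < h x.
  apply: (@compact_majorant _ _ K [set h | exists c, h = fun=> c]) => //.
  - by move=> x; apply: cvg_norm; exact: gc.
  - by exists (fun=> 0), 0.
  - by move=> _ [c ->]; exact: cst_continuous.
  - by move=> _ _ [c ->] [d ->]; exists (Num.max c d).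
  - by move=> x _; exists (fun=> `|g x| + 1); [exists (`|g x| + 1)|lra].
exists (Num.max c 1); first by rewrite lt_max ltr01 orbT.
by move=> x Kx; rewrite lt_max gh.
Qed.

Lemma sub_unif_closure g : A g -> unif_closure K A g.
Proof. by move=> Ag e e0; exists g => // x _; rewrite subrr normr0. Qed.

Lemma unif_closure_lin a g h : unif_closure K A g -> unif_closure K A h ->
  unif_closure K A (fun x => a * g x + h x).
Proof.
move=> Ag Ah e e0.
have a0 : 0 < `|a| + 1 by rewrite ltr_wpDl.
have e2 : 0 < e / 2 by rewrite divr_gt0.
have [g' Ag' gg'] := Ag _ (divr_gt0 e2 a0).
have [h' Ah' hh'] := Ah _ e2.
exists (fun x => a * g' x + h' x); first exact: fun_algL.
move=> x Kx.
have -> : a * g' x + h' x - (a * g x + h x) =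
  a * (g' x - g x) + (h' x - h x) by ring.
apply: le_lt_trans (ler_normD _ _) _; rewrite normrM [ltRHS]splitr.
apply: ler_ltD (hh' x Kx).
have := gg' x Kx; rewrite ltr_pdivlMr// => gx.
apply: le_trans (ltW gx); rewrite mulrC ler_wpM2l// lerDl//.
Qed.

(** Rescaling [g] by a bound [c] brings its values on [K] into [[-1, 1]], where
[abs_approx] applies; being polynomial, it does not leave the algebra. *)
Lemma unif_closure_abs_alg g : A g -> unif_closure K A (fun x => `|g x|).
Proof.
move=> Ag e e0; have [c c0 gc] := continuous_bounded (Acont Ag).
(* the error of [abs_approx] after [n] steps is at most [2 / n], and gets multiplied by [c] *)
pose n := (Num.truncn (2 * c / e)).+1.
have An m : A (fun x => abs_approx (c^-1 * g x) m).
  elim: m => [|m IH] /=; first exact: fun_alg_cst.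
  have Ag' : A (fun x => c^-1 * g x).
    rewrite (_ : (fun x => _) = (fun x => c^-1 * g x + 0)).
      by apply: fun_algL => //; exact: fun_alg_cst.
    by apply/funext => x; rewrite addr0.
  rewrite (_ : (fun x => _) = (fun x => 2^-1 * ((c^-1 * g x) * (c^-1 * g x)) +
    (- 2^-1 * (abs_approx (c^-1 * g x) m * abs_approx (c^-1 * g x) m) +
     abs_approx (c^-1 * g x) m))).
    by do 2?[apply: (fun_algL Aalg)] => //; apply: fun_algM.
  by apply/funext => x; ring.
exists (fun x => c * abs_approx (c^-1 * g x) n + 0).
  by apply: fun_algL => //; exact: fun_alg_cst.
move=> x Kx.
have t1 : `|c^-1 * g x| <= 1.
  by rewrite normrM gtr0_norm ?invr_gt0// mulrC ler_pdivrMr// mul1r ltW// gc.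
have := abs_approx_error n t1; set t := c^-1 * g x => err.
have -> : g x = c * t by rewrite /t mulrA mulfV ?mul1r// gt_eqF.
rewrite addr0 normrM (gtr0_norm c0) -mulrBr normrM (gtr0_norm c0).
have n0 : 0 < n%:R :> R by rewrite ltr0n.
have : 2 * c / e < n%:R by exact: truncnS_gt.
rewrite ltr_pdivrMr// => ne.
rewrite -(ltr_pM2r n0) [ltRHS]mulrC; apply: le_lt_trans ne.
by rewrite -mulrA [leRHS]mulrC ler_wpM2l// ltW.
Qed.

Lemma unif_closure_abs g : unif_closure K A g -> unif_closure K A (fun x => `|g x|).
Proof.
move=> Ag e e0.
have e2 : 0 < e / 2 by rewrite divr_gt0.
have [h Ah gh] := Ag _ e2; have [k Ak hk] := unif_closure_abs_alg Ah e2.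
exists k => // x Kx; rewrite -(subrKA `|h x|) [ltRHS]splitr.
apply: le_lt_trans (ler_normD _ _) _; apply: ltrD; first exact: hk.
by apply: le_lt_trans (ler_dist_dist _ _) _; exact: gh.
Qed.

Lemma unif_closure_max g h : unif_closure K A g -> unif_closure K A h ->
  unif_closure K A (g \max h).
Proof.
move=> Ag Ah; have A0 := sub_unif_closure (fun_alg_cst 0).
have Ad := unif_closure_abs (unif_closure_lin (-1) Ah Ag).
rewrite (_ : _ \max _ = fun x => 2^-1 * `|-1 * h x + g x| +
  (2^-1 * g x + (2^-1 * h x + 0))).
  by do 3![apply: unif_closure_lin => //].
apply/funext => x; rewrite /= maxr_absE addr0 (_ : -1 * h x + g x = g x - h x).
  by field.
by ring.
Qed.

Context (Asep : forall x y, K x -> K y -> x <> y ->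
  exists2 g, A g & g x <> g y).

Lemma alg_interpolate x y a b : K x -> K y -> (x = y -> a = b) ->
  exists2 g, A g & g x = a /\ g y = b.
Proof.
move=> Kx Ky ab; have [xy|/(Asep Kx Ky)[g Ag gxy]] := pselect (x = y).
  by exists (fun=> a); [exact: fun_alg_cst|split => //; exact: ab].
have gxy0 : g y - g x != 0 by rewrite subr_eq0 eq_sym; exact/eqP.
exists (fun z => (b - a) / (g y - g x) * g z +
                 (a - (b - a) / (g y - g x) * g x)).
  by apply: fun_algL => //; exact: fun_alg_cst.
by split; field.
Qed.

(** The continuity of the members of [A] is asked on the whole space; functions
that are continuous only on [K] are covered by taking [subspace K] for [X]. *)
Theorem stone_weierstrass f : continuous f -> unif_closure K A f.
Proof.
move=> fc e e0; have [[x0 Kx0]|K0] := pselect (K !=set0); last first.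
  exists (fun=> 0); first exact: fun_alg_cst.
  by move=> x Kx; case: K0; exists x.
have e2 : 0 < e / 2 by rewrite divr_gt0.
pose B : set (X -> R) := [set g | continuous g /\ unif_closure K A g].
have Bmax g h : B g -> B h -> B (g \max h).
  move=> [gc Ag] [hc Ah]; split; last exact: unif_closure_max.
  by move=> x; apply: continuous_max; [exact: gc|exact: hc].
have BN g : B g -> B (fun x => - g x).
  move=> [gc Ag]; split; first by move=> x; apply: cvgN; exact: gc.
  rewrite (_ : (fun x => _) = (fun x => -1 * g x + 0)).
    by apply: unif_closure_lin => //; exact: sub_unif_closure (fun_alg_cst 0).
  by apply/funext => x; ring.
have AB g : A g -> B g by move=> Ag; split; [exact: Acont|exact: sub_unif_closure].
(* For fixed [x], interpolation at [x] and [y] beats [f - e / 2] near [y]; the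
   majorant over [y] keeps the value [f x] at [x]. *)
have minorant x : K x -> exists2 h, B h &
    h x = f x /\ forall z, K z -> f z - e / 2 < h z.
  move=> Kx.
  have [|||||h [Bh hx] fh] := @compact_majorant _ _ K
      [set h | B h /\ h x = f x] (fun z => f z - e / 2) Kcompact.
  - by move=> z; apply: cvgB; [exact: fc|exact: cvg_cst].
  - by exists (fun=> f x); split => //; exact/AB/fun_alg_cst.
  - by move=> h [[]].
  - by move=> h k [Bh hx] [Bk kx]; split; [exact: Bmax|rewrite /= hx kx maxxx].
  - move=> y Ky; have [|g Ag [gx gy]] := @alg_interpolate x y (f x) (f y) Kx Ky.
      by move=> ->.
    by exists g; [split => //; exact: AB|rewrite gy; lra].
  by exists h => //; split.
(* The minimum of the minorants over [x], obtained as a majorant of [- f - e / 2]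
   among their opposites. *)
have [|||||h [Bh hf] fh] := @compact_majorant _ _ K
    [set h | B h /\ forall z, K z -> h z < e / 2 - f z]
    (fun z => - f z - e / 2) Kcompact.
- by move=> z; apply: cvgB; [apply: cvgN; exact: fc|exact: cvg_cst].
- have [h Bh [_ hf]] := minorant _ Kx0; exists (fun z => - h z).
  by split; [exact: BN|move=> z Kz; have := hf z Kz; lra].
- by move=> h [[]].
- move=> h k [Bh hf] [Bk kf]; split; first exact: Bmax.
  by move=> z Kz; rewrite /= gt_max hf// kf.
- move=> x Kx; have [h Bh [hx hf]] := minorant _ Kx; exists (fun z => - h z).
    by split; [exact: BN|move=> z Kz; have := hf z Kz; lra].
  by rewrite hx; lra.
have [_ Ah] := BN _ Bh; have [g Ag gh] := Ah _ e2.
exists g => // x Kx; rewrite -(subrKA (- h x)) [ltRHS]splitr.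
apply: le_lt_trans (ler_normD _ _) _; apply: ltrD; first exact: gh.
by rewrite ltr_norml; have := hf x Kx; have := fh x Kx; lra.
Qed.

End StoneWeierstrass.

(** * Linearity of the pairing *)

Lemma dense_continuous_eq (R : realType) (V : topologicalType) (S : set V)
    (g h : V -> R) :
  dense S -> continuous g -> continuous h -> {in S, g =1 h} -> g = h.
Proof.
move=> Sd gc hc gh; apply/funext => x; apply: contrapT => /eqP gxhx.
pose O := [set y | (g - h) y != 0].
have oO : open O.
  rewrite (_ : O = (g - h) @^-1` [set r | r != 0]) //.
  apply: open_comp; last exact: open_neq.
  by move=> y _; apply: cvgB; [exact: gc|exact: hc].
have [|y [Oy Sy]] := Sd O _ oO; first by exists x; rewrite /O /= subr_eq0.
by move: Oy; rewrite /O /= -[(g - h) y]/(g y - h y) gh ?inE// subrr eqxx.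
Qed.

Section Pairing.
Context {R : realType} {E : completeNormedModType R}.
Context {TN : admissible_tensor_norms E}.

Lemma ext_pairP n (l : tens (dual E) n) :
  @extends_pair R E TN n l !=set0 -> @extends_pair _ _ TN n l (ext_pair l).
Proof. by move=> [h hl]; exact: (xgetPex _ (ex_intro _ h hl)). Qed.

(** Algebraic tensors are dense in the completion, so that any explicit continuous
extension computes [ext_pair]. *)
Lemma ext_pair_unique n (l : tens (dual E) n) h :
  @extends_pair R E TN n l h -> ext_pair l = h.
Proof.
move=> hl; have [ec eE] := ext_pairP (ex_intro _ h hl).
case: hl => hc hE; apply: (dense_continuous_eq (@temb_dense _ _ TN n)) => //.
by move=> _ /set_mem[u _ <-]; rewrite eE hE.
Qed.

Lemma ext_pair_lin n (a : R) (l l' : tens (dual E) n) (x : tpow TN n) :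
  @extends_pair R E TN n l !=set0 -> @extends_pair _ _ TN n l' !=set0 ->
  ext_pair (a *: l + l') x = a * ext_pair l x + ext_pair l' x.
Proof.
move=> /ext_pairP[lc lE] /ext_pairP[l'c l'E].
rewrite (@ext_pair_unique _ _ (fun x => a * ext_pair l x + ext_pair l' x))//.
split; last by move=> u; rewrite lE l'E tens_pairDl.
by move=> y; apply: cvgD; [apply: cvgM; [exact: cvg_cst|exact: lc]|exact: l'c].
Qed.

Lemma ext_pair0 n (x : tpow TN n) : ext_pair (0 : tens (dual E) n) x = 0.
Proof.
rewrite (@ext_pair_unique _ _ (fun=> 0))//.
by split; [exact: cst_continuous|].
Qed.

(** The finitely supported sum that defines the pairing has a fixed finite range
beyond the degree of [l]; a common range for two tensors gives [pairing_lin]. *)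
Lemma pairing_trunc (a : tseries TN) (l : dual_tensors E) N :
  (forall n, (N <= n)%N -> dsum_val l n = 0) ->
  pairing a l = \sum_(n < N) ext_pair (dsum_val l n) (a n).
Proof.
move=> lN; rewrite /pairing (fsbig_ord _ _ (fun n => ext_pair (dsum_val l n) (a n))).
symmetry; apply: fsbig_widen => // n [_ /= /negP].
by rewrite -leqNgt => /lN ->; rewrite ext_pair0.
Qed.

Lemma dsum_bound (l : dual_tensors E) :
  exists N, forall n, (N <= n)%N -> dsum_val l n = 0.
Proof. by case: l => l /= /asboolP. Qed.

Lemma pairing_lin (s : tseries TN) (c : R) (l l' : dual_tensors E) :
  pairing_defined TN l -> pairing_defined TN l' ->
  pairing s (c *: l + l') = c * pairing s l + pairing s l'.
Proof.
move=> dl dl'; have [N lN] := dsum_bound l; have [N' l'N] := dsum_bound l'.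
have vE n : dsum_val (c *: l + l') n = c *: dsum_val l n + dsum_val l' n by [].
have lM n : (maxn N N' <= n)%N -> dsum_val l n = 0.
  by rewrite geq_max => /andP[/lN].
have l'M n : (maxn N N' <= n)%N -> dsum_val l' n = 0.
  by rewrite geq_max => /andP[_ /l'N].
have vM n : (maxn N N' <= n)%N -> dsum_val (c *: l + l') n = 0.
  by move=> n_ge; rewrite vE lM// l'M// scaler0 addr0.
rewrite (pairing_trunc _ vM) (pairing_trunc _ lM) (pairing_trunc _ l'M).
rewrite mulr_sumr -big_split; apply: eq_bigr => n _.
exact: ext_pair_lin.
Qed.

Lemma pairing_one (s : tseries TN) :
  pairing_defined TN (dual_one E) -> s 0%N = scalar_one TN ->
  pairing s (dual_one E) = 1.
Proof.
move=> d1 s0; rewrite (@pairing_trunc _ _ 1); last by case.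
rewrite big_ord_recl big_ord0 addr0 s0.
have [_ ->] := ext_pairP (d1 0%N).
by rewrite [LHS]big_ord0.
Qed.

(** Either the signature is given by a multiplicative functional, or it takes the
default value [tseries_one]; both have zeroth component 1. *)
Lemma signature_level0 (alpha T : R) (T_gt0 : 0 < T) (x : rough_path TN alpha T) :
  signature T_gt0 x 0%N = scalar_one TN.
Proof.
rewrite /signature /signature_map; by case: xgetP => [S _ [[S0 _] _]|_].

Qed.

End Pairing.

(** * Linear functionals of the signature are dense *)

Theorem theorem1p1 (R : realType) (alpha T : R)
    (alpha_in01 : 0 < alpha < 1) (T_gt0 : 0 < T)
    (E : completeNormedModType R) (TN : admissible_tensor_norms E)
    (tau : topology_on (rough_path TN alpha T))
    (tau_hausdorff : hausdorff_space (topologized tau))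
    (K : set (topologized tau)) (K_compact : compact K)
    (D : {pred dual_tensors E}) (D_subspace : submod_closed D)
    (D_defined : forall l, l \in D -> pairing_defined TN l)
    (D_continuous : forall l, l \in D ->
      {within K, continuous
        (fun x : topologized tau => pairing (signature T_gt0 x) l : R)})
    (signature_inj : forall x x' : topologized tau, K x -> K x' -> x <> x' ->
      signature T_gt0 x <> signature T_gt0 x')
    (D_one : dual_one E \in D)
    (D_separates : forall a b : tseries TN, a <> b ->
      exists2 l, l \in D & pairing a l <> pairing b l)
    (D_mul : forall l l', l \in D -> l' \in D ->
      exists2 l'', l'' \in D &
        forall x : topologized tau, K x ->
          pairing (signature T_gt0 x) l * pairing (signature T_gt0 x) l' =
          pairing (signature T_gt0 x) l'')
    (f : topologized tau -> R) (f_continuous : {within K, continuous f})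
    (eps : R) (eps_gt0 : 0 < eps) :
  exists2 l, l \in D &
    (ereal_sup [set (`|pairing (signature T_gt0 x) l - f x|)%:E | x in K]
      < eps%:E)%E.
Proof.
(* The equality is only required on [K], where [D_mul] provides the products. *)
pose A : set (subspace K -> R) := [set g | exists2 l, l \in D &
  forall x, K x -> g x = pairing (signature T_gt0 x) l].
have Aalg : function_algebra A.
  split.
  - exists (dual_one E) => // x _; rewrite pairing_one//; first exact: D_defined.
    exact: signature_level0.
  - move=> a g h [l Dl gl] [m Dm hm].
    exists (a *: l + m); first exact: D_subspace.2.
    move=> x Kx; rewrite gl// hm// pairing_lin//; exact: D_defined.
  - move=> g h [l Dl gl] [m Dm hm]; have [n Dn lmn] := D_mul l m Dl Dm.
    by exists n => // x Kx; rewrite gl// hm// lmn.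
have Acont g : A g -> continuous g.
  move=> [l Dl gl]; apply: subspace_eq_continuous (D_continuous l Dl).
  by move=> x /set_mem Kx; rewrite gl.
have Asep x y : K x -> K y -> x <> y -> exists2 g, A g & g x <> g y.
  move=> Kx Ky /(signature_inj _ _ Kx Ky)/D_separates[l Dl lxy].
  by exists (fun x => pairing (signature T_gt0 x) l) => //; exists l.
have cK : compact (K : set (subspace K)).
  by rewrite -[X in compact X]setIid; apply/compact_subspaceIP; rewrite setIid.
have eps2 : 0 < eps / 2 by rewrite divr_gt0.
have [g [l Dl gl] gf] := stone_weierstrass cK Aalg Acont Asep f_continuous eps2.
exists l => //; apply: (@le_lt_trans _ _ (eps / 2)%:E); last first.
  by rewrite lte_fin ltr_pdivrMr// ltr_pMr// ltr1n.
apply: ge_ereal_sup => _ [x Kx <-].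
by rewrite lee_fin -gl// ltW// gf.
Qed.
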